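(* Assume $Q=0$, so that $\mathcal L_\phi=D_0+\frac12\sum_{r=1}^kD_r^2$ on $(0,\infty)^n$, and let $A=(a_1,\dots,a_n)\in\mathbb R^{k\times n}$. (i) If $n=k+1$, then Hörmander's condition holds for $(D_0,D_1,\dots,D_k)$ if and only if $\operatorname{rank}(A)=k$ and the vector $(\|a_1\|^2,\dots,\|a_n\|^2)\in\mathbb R^n$ does not belong to the row space of $A$. (ii) If $n>k+1$, then Hörmander's condition fails for $(D_0,D_1,\dots,D_k)$.
   Context: Let $1\le k<n$ be integers. Let $\lambda_0,\lambda_1,\dots,\lambda_n\in\mathbb R^k$ be pairwise distinct, with $\lambda_0$ a vertex of their convex hull. Put $a_i:=\lambda_i-\lambda_0\in\mathbb R^k$ with components $a_{ir}$ ($1\le r\le k$); $A$ is the $k\times n$ matrix with columns $a_1,\dots,a_n$; $\Sigma_{ij}:=a_i\cdot a_j$; $\|\cdot\|$ is the Euclidean norm. $Q$ denotes the generator matrix of the hidden Markov chain with states $0,\dots,n$; here it is zero. For $\phi\in(0,\infty)^n$ let $y(\phi):=1+\sum_{i=1}^n\phi_i$. Define vector fields on $(0,\infty)^n$: $$D_r=\sum_{i=1}^na_{ir}\phi_i\,\partial_{\phi_i}\ (1\le r\le k),\qquad D_0=\frac1{y(\phi)}\sum_{i,j=1}^n\Sigma_{ij}\phi_i\phi_j\,\partial_{\phi_i}-\frac12\sum_{i=1}^n\|a_i\|^2\phi_i\,\partial_{\phi_i}.$$ Lie bracket: $[F,G]=FG-GF$. Hörmander's condition holds at $\phi$ if the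 values at $\phi$ of the fields $D_0,\dots,D_k$ and of all their iterated Lie brackets span $\mathbb R^n$; it holds if it holds at every $\phi\in(0,\infty)^n$, and fails otherwise. *)

(* Defs.v *)
From HB Require Import structures.
From mathcomp Require Import all_boot all_order all_algebra.
From mathcomp Require Import all_classical all_reals all_analysis.

Set Implicit Arguments.
Unset Strict Implicit.
Unset Printing Implicit Defensive.

Import Order.TTheory GRing.Theory Num.Theory.
Import numFieldNormedType.Exports.

Local Open Scope classical_set_scope.
Local Open Scope ring_scope.

Section Euclidean.
Variables (R : realType) (k : nat).

Definition dotv (u v : 'rV[R]_k) : R := \sum_(r < k) u 0 r * v 0 r.

(* The library norm `|u| on 'rV[R]_k is the max norm, hence this definition. *)
Definition enorm (u : 'rV[R]_k) : R := Num.sqrt (dotv u u).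

End Euclidean.

Section Convexity.
Variables (R : realType) (V : lmodType R).

Definition convex_hull (S : set V) : set V := smallest (@convex_set R V) S.

(* The vertices of a polytope are its extreme points. *)
Definition vertex (C : set V) (x : V) : Prop :=
  C x /\ forall (u v : V) (t : R), C u -> C v -> 0 < t < 1 ->
    x = t *: u + (1 - t) *: v -> u = x /\ v = x.

End Convexity.

Section VectorFields.
Variables (R : realType) (n : nat).

(* F : vfield stands for \sum_i (F x)_i \partial_i.  Fields are functions on
   the whole of R^n; as derivatives are local, brackets at a point of an open
   set only depend on the restrictions of the fields to that open set. *)
Definition vfield : Type := 'rV[R]_n -> 'rV[R]_n.

Definition vf_act (F : vfield) (f : 'rV[R]_n -> R) : 'rV[R]_n -> R :=
  fun x => \sum_(i < n) F x 0 i * 'D_(delta_mx 0 i) f x.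

Definition vf_comm (F G : vfield) (f : 'rV[R]_n -> R) : 'rV[R]_n -> R :=
  fun x => vf_act F (vf_act G f) x - vf_act G (vf_act F f) x.

(* The i-th component of a vector field is its value, as an operator, on the
   i-th coordinate function. *)
Definition lie_bracket (F G : vfield) : vfield :=
  fun x => \row_(i < n) vf_comm F G (fun z => z 0 i) x.

Inductive iterated_bracket (X : set vfield) : vfield -> Prop :=
| IteratedGen F : X F -> iterated_bracket X F
| IteratedBracket F G :
    iterated_bracket X F -> iterated_bracket X G ->
    iterated_bracket X (lie_bracket F G).

Definition linear_span (S : set 'rV[R]_n) : set 'rV[R]_n :=
  [set v | exists s : seq 'rV[R]_n,
     (forall u, u \in s -> S u) /\ v \in span s].

Definition hormander_at (X : set vfield) (x : 'rV[R]_n) : Prop :=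
  linear_span [set F x | F in iterated_bracket X] = setT.

Definition positive_orthant : set 'rV[R]_n :=
  [set x | forall i, 0 < x 0 i].

Definition hormander (X : set vfield) : Prop :=
  forall x, positive_orthant x -> hormander_at X x.

End VectorFields.

Section FilterFields.
Variables (R : realType) (k n : nat).

Definition increments (lambda : 'I_n.+1 -> 'rV[R]_k) : 'I_n -> 'rV[R]_k :=
  fun i => lambda (lift ord0 i) - lambda ord0.

Variable a : 'I_n -> 'rV[R]_k.

Definition colsA : 'M[R]_(k, n) := \matrix_(r < k, i < n) a i 0 r.

Definition Sigma (i j : 'I_n) : R := dotv (a i) (a j).

Definition sqnorms : 'rV[R]_n := \row_(i < n) enorm (a i) ^+ 2.

Definition ytot (phi : 'rV[R]_n) : R := 1 + \sum_(i < n) phi 0 i.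

Definition Dfield (r : 'I_k) : vfield R n :=
  fun phi => \row_(i < n) (a i 0 r * phi 0 i).

Definition D0field : vfield R n :=
  fun phi => \row_(i < n)
    ((ytot phi)^-1 * (\sum_(j < n) Sigma i j * phi 0 i * phi 0 j)
     - 2^-1 * (enorm (a i) ^+ 2 * phi 0 i)).

Definition Dfields : set (vfield R n) := [set D0field] `|` range Dfield.

End FilterFields.

(* Main.v *)
(* In the coordinates log phi_i the fields D_1, ..., D_k and
   E = sum_i |a_i|^2 phi_i d/dphi_i are constant, and D_0 is E / (-2) plus a
   combination of the D_r with function coefficients.  A constant covector w
   that kills the rows of A and (|a_1|^2, ..., |a_n|^2) therefore kills all
   the generators, hence all their iterated brackets, since a constant
   distribution is integrable.  So Hormander's condition forces the matrix
   obtained by adding the row of squared norms to A to have rank n, which is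
   impossible if n > k + 1.  Conversely, if this rank is n, then
   D_0, ..., D_k already span R^n at each point, without any bracket. *)
Require Import Defs.
From HB Require Import structures.
From mathcomp Require Import all_boot all_order all_algebra.
From mathcomp Require Import all_classical all_reals all_analysis.
From mathcomp Require Import ring.

Set Implicit Arguments.
Unset Strict Implicit.
Unset Printing Implicit Defensive.

Import Order.TTheory GRing.Theory Num.Theory.
Import numFieldNormedType.Exports.

Local Open Scope classical_set_scope.
Local Open Scope ring_scope.

(** * Rational functions on the positive orthant and their partial derivatives *)

Section OrthantFunctions.
Variables (R : realType) (n : nat).
Implicit Types (f g : 'rV[R]_n -> R) (x : 'rV[R]_n) (i j : 'I_n).

Local Notation e_ j := (delta_mx 0 j : 'rV[R]_n).

Lemma near_positive_orthant x :
  positive_orthant x -> \near x, positive_orthant x.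
Proof.
move=> x0; apply: (@filter_forall _ _ (fun i z => 0 < z 0 i) (nbhs x)) => i.
exact: (cvgr_gt _ (@coord_continuous _ _ _ 0 i x) _ (x0 i)).
Qed.

Lemma ytot_gt0 x : positive_orthant x -> 0 < ytot x.
Proof. by move=> x0; rewrite ltr_wpDr ?ltr01// sumr_ge0// => i _; exact/ltW. Qed.

Lemma is_derive_coord i j x :
  is_derive x (e_ j) (fun z : 'rV[R]_n => z 0 i) (i == j)%:R.
Proof.
have E (h : R) : h != 0 ->
    h^-1 *: ((h *: e_ j + x) 0 i - x 0 i) = (i == j)%:R :> R.
  by move=> h0; rewrite !mxE addrK eqxx /= [_ *: _]mulrA mulVf// mul1r.
have cv : (fun h : R => h^-1 *: ((h *: e_ j + x) 0 i - x 0 i)) @ 0^' -->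
    ((i == j)%:R : R).
  apply: cvg_near_cst; near=> h; apply: E.
  by near: h; exact: nbhs_dnbhs_neq.
by apply: DeriveDef; [apply/cvg_ex; exists (i == j)%:R | exact: cvg_lim].
Unshelve. all: by end_near. Qed.

Lemma is_derive_ytot j x : is_derive x (e_ j) (@ytot R n) 1.
Proof.
have -> : @ytot R n = cst 1 + \sum_i (fun z : 'rV[R]_n => z 0 i).
  by apply/funext => z; rewrite /ytot addrfctE fct_sumE.
have := is_derive_coord _ j x => dc.
apply: is_derive_eq.
rewrite add0r (bigD1 j)//= eqxx big1 ?addr0// => i /negPf ij.
by rewrite ij.
Qed.

(* ['D_v f x] is a junk value where [f] is not derivable; since this class is
   closed under partial derivatives, iterated brackets never meet that case. *)
Inductive ratfun : ('rV[R]_n -> R) -> Prop :=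
| RatCst c : ratfun (fun=> c)
| RatCoord i : ratfun (fun x => x 0 i)
| RatInvY : ratfun (fun x => (ytot x)^-1)
| RatAdd f g : ratfun f -> ratfun g -> ratfun (fun x => f x + g x)
| RatMul f g : ratfun f -> ratfun g -> ratfun (fun x => f x * g x)
| RatExt f g : (forall x, positive_orthant x -> f x = g x) ->
    ratfun f -> ratfun g.

Lemma ratfun_opp f : ratfun f -> ratfun (fun x => - f x).
Proof.
move=> rf; apply: RatExt (RatMul (RatCst (-1)) rf) => x _.
by rewrite mulN1r.
Qed.

Lemma ratfun_sum (I : Type) (r : seq I) (h : I -> 'rV[R]_n -> R) :
  (forall k, ratfun (h k)) -> ratfun (fun x => \sum_(k <- r) h k x).
Proof.
move=> rh; elim: r => [|k r IH].
  by apply: RatExt (RatCst 0) => x _; rewrite big_nil.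
by apply: RatExt (RatAdd (rh k) IH) => x _; rewrite big_cons.
Qed.

(** Induction on the class: the only denominator is [ytot], which is positive on the orthant and has
    all partial derivatives equal to 1. *)
Lemma ratfun_derive f j : ratfun f ->
  (forall x, positive_orthant x -> derivable f x (e_ j)) /\
  ratfun ('D_(e_ j) f).
Proof.
elim=> {f} [c|i||f g rf [df rdf] rg [dg rdg]|f g rf [df rdf] rg [dg rdg]
  |f g fg rf [df rdf]].
- split=> [x _|]; first exact: derivable_cst.
  apply: RatExt (RatCst 0) => x _; exact/esym/derive_cst.
- split=> [x _|]; first by have [] := is_derive_coord i j x.
  by apply: RatExt (RatCst (i == j)%:R) => x _; have [_ ->] := is_derive_coord i j x.
- split=> [x x0|].
    apply: derivableV; first by rewrite gt_eqF ?ytot_gt0.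
    by have [] := is_derive_ytot j x.
  apply: RatExt (ratfun_opp (RatMul RatInvY RatInvY)) => x x0.
  have [dy dyE] := is_derive_ytot j x.
  rewrite deriveV ?dyE ?gt_eqF ?ytot_gt0//.
  by rewrite [RHS]mulr1 expr2 invfM.
- split=> [x x0|]; first by apply: derivableD; [exact: df|exact: dg].
  apply: RatExt (RatAdd rdf rdg) => x x0.
  by rewrite -deriveD//; [exact: df|exact: dg].
- split=> [x x0|]; first by apply: derivableM; [exact: df|exact: dg].
  apply: RatExt (RatAdd (RatMul rf rdg) (RatMul rg rdf)) => x x0.
  by rewrite -[RHS]/('D_(e_ j) (f * g) x) deriveM//; [exact: df|exact: dg].
(* The orthant is open, so equality on it is equality near each of its points and passes to
   derivatives. *)
- have nfg x : positive_orthant x -> \near x, f x = g x.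
    by move=> /near_positive_orthant; apply: filterS => z; exact: fg.
  split=> [x x0|]; first exact: near_eq_derivable (nfg x x0) (df x x0).
  by apply: RatExt rdf => x x0; exact: near_eq_derive (nfg x x0).
Qed.

End OrthantFunctions.

(** * Lie brackets and constant conormals in logarithmic coordinates *)

Section LieBrackets.
Variables (R : realType) (n : nat).
Implicit Types (F G : vfield R n) (x w : 'rV[R]_n) (i j : 'I_n).

Local Notation e_ j := (delta_mx 0 j : 'rV[R]_n).

Definition ratfield F := forall i, ratfun (fun x => F x 0 i).

Lemma vf_act_coord F i : vf_act F (fun z => z 0 i) = fun x => F x 0 i.
Proof.
apply/funext => x; rewrite /vf_act (bigD1 i)//= big1 ?addr0 => [|j ji].
  by have [_ ->] := is_derive_coord i i x; rewrite eqxx mulr1.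
by have [_ ->] := is_derive_coord i j x; rewrite eq_sym (negPf ji) mulr0.
Qed.

Lemma lie_bracketE F G x i :
  lie_bracket F G x 0 i =
  vf_act F (fun z => G z 0 i) x - vf_act G (fun z => F z 0 i) x.
Proof. by rewrite mxE /vf_comm !vf_act_coord. Qed.

Lemma ratfield_lie_bracket F G :
  ratfield F -> ratfield G -> ratfield (lie_bracket F G).
Proof.
move=> rF rG i.
have act (H K : vfield R n) : ratfield H -> ratfield K ->
    ratfun (vf_act H (fun z => K z 0 i)).
  move=> rH rK; apply: ratfun_sum => j; apply: RatMul (rH j) _.
  by have [] := ratfun_derive j (rK i).
apply: RatExt (RatAdd (act _ _ rF rG) (ratfun_opp (act _ _ rG rF))) => x _.
by rewrite lie_bracketE.
Qed.

(* [w] is a constant conormal of [F] in the coordinates [log phi_i]. *)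
Definition log_conormal w F := forall x, positive_orthant x ->
  \sum_i w 0 i * (F x 0 i / x 0 i) = 0.

(* Obtained by differentiating the identity [log_conormal w G] along [F]. *)
Lemma log_conormal_act w F G x : ratfield G -> log_conormal w G ->
  positive_orthant x ->
  \sum_i w 0 i * (vf_act F (fun z => G z 0 i) x / x 0 i) =
  \sum_i w 0 i * (F x 0 i * G x 0 i / x 0 i ^+ 2).
Proof.
move=> rG wG x0.
pose q i (z : 'rV[R]_n) := w 0 i * (G z 0 i / z 0 i).
have dq i j : is_derive x (e_ j) (q i)
   (w 0 i * ('D_(e_ j) (fun z => G z 0 i) x / x 0 i
             - (i == j)%:R * (G x 0 i / x 0 i ^+ 2))).
  have [dG _] := ratfun_derive j (rG i).
  have /derivableP dGx := dG x x0.
  have [dc dcE] := is_derive_coord i j x.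
  have xi0 : x 0 i != 0 by rewrite gt_eqF.
  have dV : is_derive x (e_ j) (fun z : 'rV[R]_n => (z 0 i)^-1)
      (- (x 0 i) ^- 2 *: (i == j)%:R).
    by apply: DeriveDef; [exact: derivableV|rewrite deriveV// dcE].
  apply: is_derive_eq (is_deriveZ (w 0 i) (is_deriveM dGx dV)) _.
  by rewrite /= ![_ *: _ : R^o]/GRing.scale /=; ring.
(* The [q i] sum to zero near [x], so every partial derivative of their sum vanishes at [x]. *)
have D0 j : \sum_i w 0 i * ('D_(e_ j) (fun z => G z 0 i) x / x 0 i
             - (i == j)%:R * (G x 0 i / x 0 i ^+ 2)) = 0.
  have [_ <-] := is_derive_sum (fun i => dq i j).
  rewrite -(derive_cst (0 : R) x (e_ j)); apply: near_eq_derive.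
  apply: filterS (near_positive_orthant x0) => z z0.
  by rewrite fct_sumE; exact: wG.
apply/eqP; rewrite -subr_eq0 -sumrB; apply/eqP.
(* The difference of the two sides is the derivative along [F] of the sum of the [q i], expanded
   over the coordinate directions [j]. *)
transitivity (\sum_j F x 0 j * (\sum_i w 0 i *
   ('D_(e_ j) (fun z => G z 0 i) x / x 0 i
             - (i == j)%:R * (G x 0 i / x 0 i ^+ 2)))); last first.
  by apply: big1 => j _; rewrite D0 mulr0.
under [RHS]eq_bigr do rewrite mulr_sumr.
rewrite exchange_big; apply: eq_bigr => i _ /=.
rewrite -mulrBr.
under eq_bigr do rewrite mulrCA.
rewrite -mulr_sumr; congr (_ * _).
under eq_bigr do rewrite mulrBr.
rewrite sumrB /vf_act mulr_suml; congr (_ - _).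
  by apply: eq_bigr => j _; rewrite mulrA.
rewrite (bigD1 i)//= big1 ?addr0 => [|j /negPf ji].
  by rewrite eqxx mul1r mulrA.
by rewrite eq_sym ji mul0r mulr0.
Qed.

(* The terms of [log_conormal_act] involving no derivative are symmetric in
   [F] and [G], hence cancel in the bracket. *)
Lemma log_conormal_lie_bracket w F G :
  ratfield F -> ratfield G -> log_conormal w F -> log_conormal w G ->
  log_conormal w (lie_bracket F G).
Proof.
move=> rF rG wF wG x x0.
under eq_bigr do rewrite lie_bracketE mulrBl mulrBr.
rewrite sumrB !log_conormal_act// -sumrB big1// => i _.
by rewrite [G x 0 i * _]mulrC subrr.
Qed.

Lemma log_conormal_iterated_bracket w (X : set (vfield R n)) F :
  (forall G, X G -> ratfield G) -> (forall G, X G -> log_conormal w G) ->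
  iterated_bracket X F -> ratfield F /\ log_conormal w F.
Proof.
move=> rX wX; elim=> {F} [F XF|F G _ [rF wF] _ [rG wG]].
  by split; [exact: rX|exact: wX].
by split; [exact: ratfield_lie_bracket|exact: log_conormal_lie_bracket].
Qed.

Lemma hormander_log_conormal_eq0 w (X : set (vfield R n)) :
  (forall G, X G -> ratfield G) -> (forall G, X G -> log_conormal w G) ->
  hormander X -> w = 0.
Proof.
(* At the all-ones point the divisions by [x 0 i] disappear, so [w] is orthogonal to the value of
   each iterated bracket, hence to all of R^n. *)
move=> rX wX hX; pose x : 'rV[R]_n := const_mx 1.
have x0 : positive_orthant x by move=> i; rewrite mxE.
have wx (v : 'rV[R]_n) : \sum_i w 0 i * v 0 i = 0.
  have : linear_span [set F x | F in iterated_bracket X] v.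
    by rewrite (hX x x0).
  move=> [s [sX /(@coord_span _ _ _ (in_tuple s)) ->]].
  under eq_bigr do rewrite summxE mulr_sumr.
  rewrite exchange_big big1//= => j _.
  have /sX[F /(log_conormal_iterated_bracket rX wX)[_ /(_ x x0)] wF <-] :
    s`_j \in s by rewrite mem_nth.
  under eq_bigr do rewrite mxE mulrCA.
  rewrite -mulr_sumr -[RHS](mulr0 (coord (in_tuple s) j v)); congr (_ * _).
  rewrite -[RHS]wF; apply: eq_bigr => i _.
  by rewrite [x 0 i]mxE divr1.
apply/rowP => i; rewrite mxE.
have := wx (e_ i); rewrite (bigD1 i)//= big1 ?addr0 => [|j /negPf ji].
  by rewrite mxE !eqxx mulr1.
by rewrite mxE ji andbF mulr0.
Qed.

End LieBrackets.

(** * Hörmander's condition as a rank condition *)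

Section HormanderRank.
Variables (R : realType) (k n : nat) (a : 'I_n -> 'rV[R]_k).
Implicit Types (F G : vfield R n) (x w : 'rV[R]_n) (i j : 'I_n) (r : 'I_k).

(** Component [r] of the mean of 0, a_1, ..., a_n under the weights 1, x_1, ..., x_n, whose total is
    [ytot x]. *)
Definition weighted_mean r x : R := (ytot x)^-1 * \sum_j a j 0 r * x 0 j.

Definition sqnorm_field : vfield R n := fun x => \row_i (sqnorms a 0 i * x 0 i).

(** Expanding the inner products in [Sigma] over [r] and exchanging the sums splits the quadratic
    part of [D0field] along the fields [Dfield a r]. *)
Lemma D0fieldE x : D0field a x =
  \sum_r weighted_mean r x *: Dfield a r x - 2^-1 *: sqnorm_field x.
Proof.
apply/rowP => i; rewrite !mxE summxE; congr (_ - _).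
rewrite mulr_sumr /Sigma /dotv.
under eq_bigr do rewrite mulr_suml mulr_suml mulr_sumr.
rewrite exchange_big; apply: eq_bigr => r _ /=.
rewrite !mxE /weighted_mean mulr_sumr mulr_suml.
by apply: eq_bigr => j _; ring.
Qed.

Lemma ratfield_Dfields F : Dfields a F -> ratfield F.
Proof.
have rc c i : ratfun (fun x => c * x 0 i) by exact: RatMul (RatCst _ _) (RatCoord _ _).
move=> [->|[r _ <-]] i; last by apply: RatExt (rc (a i 0 r) i) => x _; rewrite mxE.
apply: (@RatExt _ _ (fun x => (ytot x)^-1 * (\sum_j Sigma a i j * x 0 i * x 0 j)
    + - (2^-1 * (enorm (a i) ^+ 2 * x 0 i)))); first by move=> x _; rewrite mxE.
apply: RatAdd; last exact: ratfun_opp (RatMul (RatCst _ _) (rc _ _)).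
apply: (RatMul (RatInvY _ _)).
by apply: ratfun_sum => j; exact: RatMul (rc _ _) (RatCoord _ _).
Qed.

Lemma log_conormal_Dfields w F : w *m (col_mx (colsA a) (sqnorms a))^T = 0 ->
  Dfields a F -> log_conormal w F.
Proof.
(* Writing 0 as a block row separates the hypothesis into [w] killing the rows of A and [w] killing
   the squared norms. *)
rewrite tr_col_mx mul_mx_row -(row_mx0 _ 1 k 1) => /eq_row_mx[wA ws].
have wD r x : positive_orthant x ->
    \sum_i w 0 i * (Dfield a r x 0 i / x 0 i) = 0.
  move=> x0; have := congr1 (fun M : 'rV_k => M 0 r) wA; rewrite !mxE => wAr.
  rewrite -[RHS]wAr; apply: eq_bigr => i _.
  by rewrite !mxE mulfK ?gt_eqF.
have wS x : positive_orthant x ->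
    \sum_i w 0 i * (sqnorm_field x 0 i / x 0 i) = 0.
  move=> x0; have := congr1 (fun M : 'rV_1 => M 0 0) ws; rewrite !mxE => ws0.
  rewrite -[RHS]ws0; apply: eq_bigr => i _.
  by rewrite !mxE mulfK ?gt_eqF.
move=> [->|[r _ <-]] x x0; last exact: wD.
under eq_bigr do
  rewrite D0fieldE 2!mxE summxE mulrBl mulrBr mulr_suml mulr_sumr.
rewrite sumrB exchange_big /= big1 => [|r _].
  under eq_bigr do rewrite mxE -mulrA mulrCA.
  by rewrite -mulr_sumr wS// mulr0 subr0.
under eq_bigr do rewrite mxE -mulrA mulrCA.
by rewrite -mulr_sumr wD// mulr0.
Qed.

Lemma hormander_rank :
  hormander (Dfields a) -> \rank (col_mx (colsA a) (sqnorms a)) = n.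
Proof.
(* Full column rank is stated as triviality of the left kernel of the transpose, whose elements are
   conormal to all generators. *)
move=> hD; rewrite -mxrank_tr; apply/eqP; rewrite -/(row_free _) -kermx_eq0.
apply/rowV0P => w /sub_kermxP wM.
apply: hormander_log_conormal_eq0 hD; first exact: ratfield_Dfields.
by move=> G; exact: log_conormal_Dfields.
Qed.

Lemma rank_hormander :
  row_full (col_mx (colsA a) (sqnorms a)) -> hormander (Dfields a).
Proof.
move=> full x x0; apply/seteqP; split=> // v _.
pose s := D0field a x :: [seq Dfield a r x | r <- enum 'I_k].
exists s; split=> [u|].
  rewrite inE => /predU1P[->|/mapP[r _ ->]].
    by exists (D0field a) => //; apply: IteratedGen; left.
  by exists (Dfield a r) => //; apply: IteratedGen; right; exists r.
have sD r : Dfield a r x \in span s.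
  apply: memv_span; rewrite inE; apply/predU1P; right.
  by apply/mapP; exists r; rewrite ?mem_enum.
have sS : sqnorm_field x \in span s.
  (* [D0fieldE] solved for [sqnorm_field]. *)
  have -> : sqnorm_field x =
      2 *: (\sum_r weighted_mean r x *: Dfield a r x - D0field a x).
    by rewrite D0fieldE opprB addrCA subrr addr0 scalerA mulfV ?scale1r.
  apply/memvZ/memvB; last exact/memv_span/mem_head.
  by apply: memv_suml => r _; exact/memvZ.
(* The logarithmic components of [v] are a combination of the rows; multiplying back by [x 0 i]
   turns the rows into values of the fields. *)
have /submxP[c cE] := submx_full (\row_i (v 0 i / x 0 i)) full.
have -> : v = \sum_r lsubmx c 0 r *: Dfield a r x + rsubmx c 0 0 *: sqnorm_field x.
  apply/rowP => i; have := congr1 (fun u : 'rV_n => u 0 i * x 0 i) cE.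
  rewrite /= -{1}[c]hsubmxK mul_row_col 2!mxE ![(_ *m _) 0 i]mxE.
  rewrite [LHS]mulrAC mulfK ?gt_eqF// => ->.
  rewrite big_ord1 [RHS]mxE summxE mulrDl mulr_suml; congr (_ + _); last first.
    by rewrite [RHS]mxE [sqnorm_field x _ _]mxE mulrA.
  by apply: eq_bigr => r _; rewrite !mxE mulrA.
apply/memvD; last exact/memvZ.
by apply: memv_suml => r _; exact/memvZ.
Qed.

End HormanderRank.

Lemma mxrank_col_row (F : fieldType) (m n : nat) (A : 'M[F]_(m, n)) (u : 'rV[F]_n) :
  \rank (col_mx A u) = (\rank A + ~~ (u <= A)%MS)%N.
Proof.
rewrite -addsmxE; have [uA|nuA] := boolP (u <= A)%MS.
  by rewrite addn0 (addsmx_idPl uA).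
apply/eqP; rewrite eqn_leq; apply/andP; split.
  by rewrite (leq_trans (mxrank_adds_leqif _ _).1)// leq_add2l rank_leq_row.
(* If the rank did not grow, [A] and [A + u] would have the same row space, which would then contain
   [u]. *)
rewrite addn1 ltnNge; apply: contra nuA => rA.
have /andP[_ /(submx_trans (addsmxSr A u))//] : (A == A + u)%MS.
by rewrite -(mxrank_leqif_eq (addsmxSl A u)) eqn_leq rA mxrankS ?addsmxSl.
Qed.

Theorem theorem4p4 (R : realType) (k n : nat)
  (hk : (1 <= k)%N) (hkn : (k < n)%N)
  (lambda : 'I_n.+1 -> 'rV[R]_k)
  (lambda_inj : injective lambda)
  (lambda0_vertex : vertex (convex_hull (range lambda)) (lambda ord0)) :
  let a := increments lambda in
  (n = k.+1 ->
     (hormander (Dfields a) <->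
      \rank (colsA a) = k /\ ~~ (sqnorms a <= colsA a)%MS)) /\
  ((k.+1 < n)%N -> ~ hormander (Dfields a)).
Proof.
move=> a; split=> [nk|kn /hormander_rank rn]; last first.
  by have := rank_leq_row (col_mx (colsA a) (sqnorms a)); rewrite rn addn1 leqNgt kn.
split=> [/hormander_rank|[rA nsA]].
  (* As A has rank at most [k], a total rank of [k.+1] forces both rank [k] and a contribution from
     the squared norms. *)
  rewrite mxrank_col_row [RHS]nk; have := rank_leq_row (colsA a).
  case: (~~ _) => [|/[swap]]; first by rewrite addn1 => _ [].
  by rewrite addn0 => ->; rewrite ltnn.
by apply: rank_hormander; rewrite /row_full mxrank_col_row rA nsA addn1 nk.
Qed.
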